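(* Let $\Sigma_{\mathrm{FD}}$ be a set of functional dependencies and $\Sigma_{\mathrm{UMI}}$ a set of unary marginal identities. Let $\Sigma=\Sigma_{\mathrm{FD}}\cup\Sigma_{\mathrm{UMI}}$ and $\Sigma^*=\Sigma_{\mathrm{FD}}\cup\{x\subseteq y\mid x\approx y\in\Sigma_{\mathrm{UMI}}\text{ or }y\approx x\in\Sigma_{\mathrm{UMI}}\}$. Then for all functional dependencies $\sigma$ and unary marginal identities $x\approx y$: (i) $\Sigma\models\sigma$ if and only if $\Sigma^*\models\sigma$; (ii) $\Sigma\models x\approx y$ if and only if $\Sigma^*\models x\subseteq y$ and $\Sigma^*\models y\subseteq x$.
   Context: An assignment is $s\colon D\to A$ ($D$ a finite set of variables); a team $X$ is a finite set of assignments, $X(x)=\{s(x)\mid s\in X\}$; a probabilistic team is $\mathbb{X}\colon X\to(0,1]$ with $\sum_s\mathbb{X}(s)=1$, and $|\mathbb{X}_{x=a}|=\sum_{s(x)=a}\mathbb{X}(s)$. Semantics: $\mathbb{X}\models\,=\!(\bar{x},\bar{y})$ iff assignments of $X$ agreeing on $\bar{x}$ agree on $\bar{y}$ ($\bar{x}$ may be empty); $\mathbb{X}\models x\approx y$ iff $|\mathbb{X}_{x=a}|=|\mathbb{X}_{y=a}|$ for all $a$; the unary inclusion atom $\mathbb{X}\models x\subseteq y$ iff $X(x)\subseteq X(y)$. For a set $\Gamma\cup\{\gamma\}$ of atoms, $\Gamma\models\gamma$ means every finite probabilistic team satisfying $\Gamma$ satisfies $\gamma$. *)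

(* Defs.v *)
From HB Require Import structures.
From mathcomp Require Import all_boot all_order all_algebra finmap.
From mathcomp Require Import boolp classical_sets reals.

Set Implicit Arguments.
Unset Strict Implicit.
Unset Printing Implicit Defensive.

Import Order.TTheory GRing.Theory Num.Theory.

Local Open Scope ring_scope.

Section Teams.

Variables (R : realType) (D : finType) (A : choiceType).

Definition assignment : Type := {ffun D -> A}.

Definition team : Type := {fset {ffun D -> A}}.

Definition team_values (X : team) (x : D) : {fset A} :=
  [fset (s : {ffun D -> A}) x | s in X]%fset.

Record prob_team := ProbTeam {
  support : team;
  weight : support -> R;
  weight_itv : forall s : support, 0 < weight s <= 1;
  weight_sum : \sum_(s : support) weight s = 1
}.

Definition marginal (P : prob_team) (x : D) (a : A) : R :=
  \sum_(s : support P | fsval s x == a) weight s.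

Definition agree (xs : seq D) (s t : assignment) : Prop :=
  [seq s x | x <- xs] = [seq t x | x <- xs].

End Teams.

Variant atom (D : finType) :=
  | Dep of seq D & seq D
  | MarginalId of D & D
  | Incl of D & D.

Definition sat (R : realType) (D : finType) (A : choiceType)
    (P : prob_team R D A) (phi : atom D) : Prop :=
  match phi with
  | Dep xs ys => forall s t : {ffun D -> A},
      s \in support P -> t \in support P -> agree xs s t -> agree ys s t
  | MarginalId x y => forall a : A, marginal P x a = marginal P y a
  | Incl x y =>
      (team_values (support P) x `<=` team_values (support P) y)%fset
  end.

(* The value set A varies with the team; it may be infinite, but every team
   is a finite set of assignments.                                          *)
Definition entails (R : realType) (D : finType)
    (Gamma : set (atom D)) (phi : atom D) : Prop :=
  forall (A : choiceType) (P : prob_team R D A),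
    (forall psi, Gamma psi -> sat P psi) -> sat P phi.

(* A set of functional dependencies is given by the pairs of variable tuples
   of its atoms, a set of unary marginal identities by its pairs of variables. *)
Definition fd_atoms (D : finType) (S : set (seq D * seq D)) : set (atom D) :=
  [set Dep p.1 p.2 | p in S]%classic.

Definition umi_atoms (D : finType) (S : set (D * D)) : set (atom D) :=
  [set MarginalId p.1 p.2 | p in S]%classic.

Definition incl_atoms (D : finType) (S : set (D * D)) : set (atom D) :=
  [set Incl p.1 p.2 | p in [set p | S (p.1, p.2) \/ S (p.2, p.1)]]%classic.

(* Main.v *)
Require Import Defs.
From mathcomp Require Import all_boot all_order all_algebra finmap.
From mathcomp Require Import boolp classical_sets reals.

(** A marginal identity forces equal value sets, so entailment from Sigma* passes
    to Sigma. For (ii), a one-row team satisfies every dependency, and it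
    satisfies the identities (resp. inclusions) iff its row is constant along
    them; taking as value of z the value set (resp. the marginal) of z in a given
    team turns equality of values into what has to be proved.

    For the converse in (i), let X be a team satisfying Sigma* with rows s, t
    refuting the dependency. Call a set of variables closed if it is closed under
    the dependencies of X, for instance W = {z | s z = t z} and cl u = {v | u
    determines v}. If u determines v then |X(v)| <= |X(u)|, with equality only if
    v determines u. Hence one can choose multiplicities on closed sets, positive
    on W, such that the number of chosen sets containing v depends only on
    |X(v)|. Give each chosen set Z two rows agreeing exactly on Z, rows of
    different sets agreeing only on constants, all with the same weight. This
    satisfies the dependencies of X, the pair of W refutes the same dependency as
    s, t, and after relabelling values the marginal of v depends only on
    |X(v)|. *)

Set Implicit Arguments.
Unset Strict Implicit.
Unset Printing Implicit Defensive.

Import Order.TTheory GRing.Theory Num.Theory.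

(** * Teams given by indexed families of rows *)

(** Several indices may name the same row, whose weight is then the share of indices naming it. *)
Lemma uniform_team (R : realType) (D : finType) (A : choiceType)
    (I : finType) (i0 : I) (r : I -> {ffun D -> A}) :
  exists P : prob_team R D A,
    (forall s, s \in Defs.support P <-> exists i, s = r i) /\
    (forall x a, marginal P x a = \sum_(i | r i x == a) #|I|%:R^-1)%R.
Proof.
pose X : {fset {ffun D -> A}} := [fset r i | i in I]%fset.
have rX i : r i \in X by apply/imfsetP; exists i.
pose g i : X := FSetSub (rX i).
have card_gt0 : (0 < #|I|%:R :> R)%R.
  by rewrite ltr0n; apply/card_gt0P; exists i0.
have w_gt0 : (0 < #|I|%:R^-1 :> R)%R by rewrite invr_gt0.
pose w (s : X) : R := (\sum_(i | g i == s) #|I|%:R^-1)%R.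
have w_sum : (\sum_(s : X) w s = 1)%R.
  transitivity (\sum_(i : I) #|I|%:R^-1 : R)%R.
    by rewrite [RHS](partition_big g xpredT).
  by rewrite sumr_const -[LHS]mulr_natr mulVf ?gt_eqF.
have w_ge0 (s : X) : (0 <= w s)%R by apply: sumr_ge0 => i _; apply: ltW.
have w_itv (s : X) : (0 < w s <= 1)%R.
  apply/andP; split; last first.
    by rewrite -w_sum (bigD1 s) //= lerDl sumr_ge0.
  have /imfsetP[i _ Ei] := fsvalP s.
  have gi : g i == s by apply/eqP/val_inj; rewrite /= -Ei.
  by rewrite /w (bigD1 i) //= ltr_pwDl // sumr_ge0 // => j _; apply: ltW.
exists (ProbTeam w_itv w_sum); split=> [s | x a].
  split=> [/imfsetP[i _ ->] | [i ->]]; last exact: rX.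
  by exists i.
rewrite /marginal /= [RHS](partition_big g (fun s : X => fsval s x == a)) //=.
apply: eq_bigr => s /eqP sx; apply: eq_bigl => i.
have [e|_] := eqVneq (g i) s; last by rewrite andbF.
by rewrite andbT -sx -e eqxx.
Qed.

Lemma agreeP (D : finType) (A : choiceType) (xs : seq D) (s t : {ffun D -> A}) :
  agree xs s t <-> {in xs, s =1 t}.
Proof. by split=> /eq_in_map. Qed.

Lemma uniform_team_sat (R : realType) (D : finType) (A : choiceType)
    (I : finType) (i0 : I) (r : I -> {ffun D -> A}) :
  exists P : prob_team R D A, [/\
    forall xs ys, sat P (Dep xs ys) <->
      (forall i j, {in xs, r i =1 r j} -> {in ys, r i =1 r j}),
    forall x y, sat P (Incl x y) <-> forall i, exists j, r i x = r j y &
    forall x y, sat P (MarginalId x y) <-> forall a,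
      (\sum_(i | r i x == a) #|I|%:R^-1 =
       \sum_(i | r i y == a) #|I|%:R^-1 :> R)%R].
Proof.
have [P [PX Pm]] := uniform_team R i0 r.
have rP i : r i \in Defs.support P by apply/PX; exists i.
exists P; split=> [xs ys | x y | x y] /=.
- split=> [h i j /agreeP e | h s t /PX[i ->] /PX[j ->] /agreeP e].
    exact/agreeP/h.
  exact/agreeP/h.
- split=> [/fsubsetP h i | h].
    have /h/imfsetP[s /= /PX[j ->]] : r i x \in team_values (Defs.support P) x.
      by apply/imfsetP; exists (r i).
    by exists j.
  apply/fsubsetP => a /imfsetP[s /= /PX[i ->] ->].
  by have [j ->] := h i; apply/imfsetP; exists (r j).
- by split=> h a; have := h a; rewrite !Pm.
Qed.

(** Weights are positive, so a value taken by [x] has positive marginal, which forces [y] to take it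
    too. *)
Lemma MarginalId_Incl (R : realType) (D : finType) (A : choiceType)
    (P : prob_team R D A) (x y : D) :
  sat P (MarginalId x y) -> sat P (Incl x y).
Proof.
move=> /= xy; apply/fsubsetP => a /imfsetP[s /= sP ->].
have w_ge0 (u : Defs.support P) : (0 <= weight u)%R.
  by have /andP[/ltW] := weight_itv u.
have : (0 < marginal P x (s x))%R.
  rewrite /marginal (bigD1 [` sP]%fset) //= ltr_pwDl ?sumr_ge0 //.
  by have /andP[] := weight_itv [` sP]%fset.
rewrite xy /marginal; apply: contraTT => nyx; rewrite big1 ?ltxx // => u /eqP ux.
by case/negP: nyx; rewrite -ux; apply/imfsetP; exists (fsval u) => //; exact: fsvalP.
Qed.

(** * One-row teams *)

Section SingletonTeams.

Variables (R : realType) (D : finType) (A : choiceType).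
Variables (FD : set (seq D * seq D)) (UMI : set (D * D)) (k : D -> A).
Hypothesis kP : forall x y, UMI (x, y) -> k x = k y.

Lemma entails_MarginalId_eq (x y : D) :
  entails R (fd_atoms FD `|` umi_atoms UMI)%classic (MarginalId x y) -> k x = k y.
Proof.
have [P [PD PI PM]] := uniform_team_sat R tt (fun _ => [ffun z => k z]).
move/(_ A P) => h; apply/eqP; apply: contraT => kxy.
suff /PM/(_ (k x)) : sat P (MarginalId x y).
  rewrite !(big_mkcond (fun _ => _ == _)) !(big_pred1 tt) //= !ffunE eqxx.
  rewrite eq_sym (negPf kxy) card_unit => /eqP.
  by rewrite invr1 oner_eq0.
apply: h => psi [[p _ <-] | [[u v] /= uv <-]]; first by apply/PD => i j _ z.
by apply/PM => a; apply: eq_bigl => i; rewrite !ffunE (kP uv).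
Qed.

Lemma entails_Incl_eq (x y : D) :
  entails R (fd_atoms FD `|` incl_atoms UMI)%classic (Incl x y) -> k x = k y.
Proof.
have [P [PD PI PM]] := uniform_team_sat R tt (fun _ => [ffun z => k z]).
move/(_ A P) => h.
suff /PI/(_ tt)[_] : sat P (Incl x y) by rewrite !ffunE.
apply: h => psi [[p _ <-] | [[u v] /= uv <-]]; first by apply/PD => i j _ z.
by apply/PI => -[]; exists tt; rewrite !ffunE; case: uv => /kP.
Qed.

End SingletonTeams.

(** * Sets of variables closed under the dependencies of a team *)

Section Dependencies.

Variables (D : finType) (A : choiceType) (X : {fset {ffun D -> A}}).
Implicit Types (s t r : {ffun D -> A}) (u v : D) (Z : {set D}).

Definition determines (us : seq D) v : Prop := forall s t,
  s \in X -> t \in X -> {in us, s =1 t} -> s v = t v.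

Definition fd_closed Z : Prop := forall us v,
  determines us v -> {subset us <= Z} -> v \in Z.

Definition fd_closure u : {set D} := [set v | `[< determines [:: u] v >]].

Definition nvals v : nat := #|` team_values X v|%fset.

Lemma determines1 u v : determines [:: u] v <->
  forall s t, s \in X -> t \in X -> s u = t u -> s v = t v.
Proof.
split=> h s t sX tX e; apply: h => //; last by apply: e; rewrite inE.
by move=> w; rewrite inE => /eqP->.
Qed.

Lemma agreement_closed s t : s \in X -> t \in X ->
  fd_closed [set z | s z == t z].
Proof.
move=> sX tX us v d h; rewrite inE; apply/eqP/(d s t sX tX) => z /h.
by rewrite inE => /eqP.
Qed.

Lemma fd_closure_closed u : fd_closed (fd_closure u).
Proof.
move=> us v d h; rewrite inE; apply/asboolP/determines1 => s t sX tX e.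
apply: d => // z /h; rewrite inE => /asboolP/determines1; exact.
Qed.

Lemma fd_closure_id u : u \in fd_closure u.
Proof. by rewrite inE; apply/asboolP/determines1. Qed.

Lemma fd_closure_min u Z : fd_closed Z -> u \in Z -> fd_closure u \subset Z.
Proof.
move=> cZ uZ; apply/fintype.subsetP => v; rewrite inE => /asboolP/cZ; apply.
by move=> w; rewrite inE => /eqP->.
Qed.

(** On [X], [v] is a function of [u], and the values of [u] in [B] already reach every value of
    [v]. *)
Lemma determines_nvals u v (B : {fset A}) : determines [:: u] v ->
  (forall r, r \in X -> exists2 r', r' \in X & r' v = r v /\ r' u \in B) ->
  nvals v <= #|` B|.
Proof.
move=> /determines1 d h; have [X0|[s0 s0X]] := fset_0Vmem X.
  by rewrite /nvals /team_values X0 imfset0 cardfs0.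
pose g a := if [pick r : X | fsval r u == a] is Some r then fsval r v else s0 v.
apply: leq_trans (leq_imfset_card imfset_key g (mem B)); apply: fsubset_leq_card.
apply/fsubsetP => a /imfsetP[r /= rX ->]; have [r' r'X [<- r'B]] := h r rX.
apply/imfsetP; exists (r' u) => //; rewrite /g.
case: pickP => [q /eqP e | /(_ [` r'X]%fset)]; last by rewrite eqxx.
by apply: d => //; exact: fsvalP.
Qed.

Lemma fd_closure_nvals u v : v \in fd_closure u -> nvals v <= nvals u.
Proof.
rewrite inE => /asboolP d; apply: determines_nvals (d) _ => r rX.
by exists r => //; split=> //; apply/imfsetP; exists r.
Qed.

(* If two values of [u] gave the same value of [v], then dropping one of them
   would still reach every value of [v], so [v] would have fewer values. *)
Lemma fd_closure_sym u v : v \in fd_closure u -> nvals u <= nvals v ->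
  fd_closure v = fd_closure u.
Proof.
move=> uv le_uv; apply/eqP; rewrite finset.eqEsubset.
rewrite !fd_closure_min //; try exact: fd_closure_closed.
rewrite inE; apply/asboolP/determines1 => s t sX tX stv.
move: uv; rewrite inE => /asboolP d; apply/eqP; apply: contraT => stu.
have suX : s u \in team_values X u by apply/imfsetP; exists s.
suff : nvals v <= #|` team_values X u `\ s u|%fset.
  move/(leq_trans le_uv); rewrite /nvals (cardfsD1 (s u) (team_values X u)) suX.
  by rewrite add1n ltnn.
apply: determines_nvals (d) _ => r rX; have [ru|ru] := eqVneq (r u) (s u).
  exists t => //; split; last first.
    by rewrite !inE eq_sym stu; apply/imfsetP; exists t.
  by rewrite -stv; apply/esym; move/determines1: d; apply.
by exists r => //; split=> //; rewrite !inE ru; apply/imfsetP; exists r.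
Qed.

End Dependencies.

(** * Balancing the multiplicities of closed sets *)

(* Processing the levels of [c] from the top, each [v] of the current level can
   be topped up with copies of [cl v]: these meet the level only in the class
   of [v] and do not touch the levels above. *)
Lemma balanced_multiplicities (D : finType) (c : D -> nat)
    (closed : {set D} -> Prop) (cl : D -> {set D}) (W : {set D}) :
  (forall u, u \in cl u) -> (forall u, closed (cl u)) ->
  (forall u Z, closed Z -> u \in Z -> cl u \subset Z) ->
  (forall u v, v \in cl u -> c v <= c u) ->
  (forall u v, v \in cl u -> c u <= c v -> cl v = cl u) ->
  closed W ->
  exists a : {set D} -> nat, [/\ 0 < a W, forall Z, 0 < a Z -> closed Z &
    forall u v, c u = c v ->
      \sum_(Z : {set D} | u \in Z) a Z = \sum_(Z : {set D} | v \in Z) a Z].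
Proof.
move=> cl_id cl_closed cl_min c_le cl_eq Wclosed.
(* Only levels from [n] up are balanced; beyond the maximum of [c] there are none, so one copy of
   [W] suffices. *)
pose bal n := exists a : {set D} -> nat,
  [/\ 0 < a W, forall Z, 0 < a Z -> closed Z &
    forall u v, c u = c v -> n <= c u ->
      \sum_(Z : {set D} | u \in Z) a Z = \sum_(Z : {set D} | v \in Z) a Z].
suff bal_dec n : bal n.+1 -> bal n.
  have : bal (\max_v c v).+1.
    exists (fun Z => nat_of_bool (Z == W)); split=> [|Z|u v _].
    - by rewrite eqxx.
    - by case: eqP => // ->.
    - by rewrite ltnNge leq_bigmax.
  elim: _.+1 => [[a [aW aC ab]]|m IH /bal_dec //].
  by exists a; split=> // u v e; apply: ab.
move=> [a [aW aC ab]].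
(* A closed set contains [v] iff it contains [cl v], so [F (cl v)] is the count at [v]. Since [M]
   bounds all counts, [M - F (cl v)] further copies of [cl v] lift the count at [v] to exactly
   [M]. *)
pose F (Y : {set D}) := \sum_(Z : {set D} | Y \subset Z) a Z.
pose M := \sum_(Z : {set D}) a Z.
have F_le Y : F Y <= M by rewrite /F big_mkcond leq_sum // => Z _; case: ifP.
have F_cl v : \sum_(Z : {set D} | v \in Z) a Z = F (cl v).
  rewrite /F big_mkcond [RHS]big_mkcond /=; apply: eq_bigr => Z _.
  have [->|aZ] := posnP (a Z); first by rewrite !if_same.
  suff -> : (v \in Z) = (cl v \subset Z) by [].
  apply/idP/idP => [|/fintype.subsetP]; last exact.
  exact/cl_min/aC.
(* Collecting sets rather than variables ensures that a closure shared by several variables is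
   topped up once. *)
pose L := [set cl u | u in [pred u | c u == n]].
exists (fun Z => a Z + (if Z \in L then M - F Z else 0)); split.
- exact: ltn_addr.
- move=> Z; rewrite addn_gt0 => /orP[/aC //|].
  by case: ifP => // /finset.imsetP[u _ ->].
have above v : n < c v ->
    \sum_(Z : {set D} | v \in Z) (if Z \in L then M - F Z else 0) = 0.
  move=> nv; apply: big1 => Z vZ; case: ifP => // /finset.imsetP[u].
  rewrite inE => /eqP un Zu; move: vZ; rewrite Zu => /c_le.
  by rewrite un leqNgt nv.
have level v : c v = n ->
    \sum_(Z : {set D} | v \in Z) (if Z \in L then M - F Z else 0) = M - F (cl v).
  move=> vn; rewrite (bigD1 (cl v)) //= ifT; last first.
    by apply/finset.imsetP; exists v; rewrite ?inE ?vn.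
  rewrite big1 ?addn0 // => Z /andP[vZ nZ].
  case: ifP => // /finset.imsetP[u]; rewrite inE => /eqP un Zu.
  by move: nZ; rewrite Zu (cl_eq u v) ?eqxx ?un ?vn // -Zu.
move=> u v uv; rewrite !big_split /= leq_eqVlt => /orP[/eqP un|nu].
  by rewrite !level -?uv // !F_cl !subnKC.
by rewrite (ab u v) // !above // -uv.
Qed.

(** * Matching two subsets of equal size *)

Section Rank.

Variables (J : finType).
Implicit Types (P Q : pred J) (j : J).

(* Position in the enumeration of [J] that lists the elements of [P] first. *)
Definition rank P j : nat :=
  index j ([seq i <- enum J | P i] ++ [seq i <- enum J | ~~ P i]).

Lemma rank_perm P :
  perm_eq ([seq i <- enum J | P i] ++ [seq i <- enum J | ~~ P i]) (enum J).
Proof. by rewrite perm_filterC. Qed.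

Lemma mem_rank P j :
  j \in [seq i <- enum J | P i] ++ [seq i <- enum J | ~~ P i].
Proof. by rewrite (perm_mem (rank_perm P)) mem_enum. Qed.

Lemma rank_inj P : injective (rank P).
Proof. by move=> i j; apply: (index_inj i (mem_rank P i) (mem_rank P j)). Qed.

Lemma rank_lt P j : (rank P j < #|P|) = P j.
Proof.
have -> : #|P| = size [seq i <- enum J | P i].
  by rewrite size_filter -sum1_count big_enum_cond sum1_card.
rewrite /rank index_cat mem_filter mem_enum andbT.
case: ifP => Pj; first by rewrite index_mem mem_filter Pj mem_enum.
by rewrite ltnNge leq_addr.
Qed.

(** Equal positions of the two enumerations are matched; [P] and [Q] fill initial segments of the
    same length, so membership is preserved. *)
Lemma rank_match P Q : #|P| = #|Q| ->
  exists2 h : J -> J, injective h &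
    forall j, rank Q (h j) = rank P j /\ Q (h j) = P j.
Proof.
move=> PQ.
pose l S := [seq i <- enum J | S i] ++ [seq i <- enum J | ~~ S i].
pose h j := nth j (l Q) (rank P j).
have rank_size S j : rank S j < size (l S) by rewrite index_mem mem_rank.
have hE j : rank Q (h j) = rank P j.
  rewrite /rank index_uniq //.
    by rewrite (perm_size (rank_perm Q)) -(perm_size (rank_perm P)) rank_size.
  by rewrite (perm_uniq (rank_perm Q)) enum_uniq.
exists h => [i j /(congr1 (rank Q))|j]; first by rewrite !hE => /rank_inj.
by rewrite -rank_lt hE -PQ rank_lt.
Qed.

End Rank.

(** * The team with balanced marginals *)

Lemma balanced_team (R : realType) (D : finType) (A : choiceType)
    (X : {fset {ffun D -> A}}) (UMI : set (D * D)) (s t : {ffun D -> A}) :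
  s \in X -> t \in X ->
  (forall x y, UMI (x, y) -> team_values X x = team_values X y) ->
  exists P : prob_team R D (nat * bool)%type, [/\
    forall us vs, {in vs, forall v, determines X us v} -> sat P (Dep us vs),
    forall x y, UMI (x, y) -> sat P (MarginalId x y) &
    forall us vs, sat P (Dep us vs) -> {in us, s =1 t} -> {in vs, s =1 t}].
Proof.
move=> sX tX umi.
have [a [aW a_closed a_bal]] := balanced_multiplicities
  (@fd_closure_id _ _ X) (@fd_closure_closed _ _ X) (@fd_closure_min _ _ X)
  (@fd_closure_nvals _ _ X) (@fd_closure_sym _ _ X) (agreement_closed sX tX).
set W := finset _ in aW.
pose J : finType := {Z : {set D} & 'I_(a Z)}.
have tag_closed (j : J) : fd_closed X (tag j).
  by apply: a_closed; case: j => Z k; exact: leq_ltn_trans (ltn_ord k).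
pose const v := `[< determines X [::] v >].
have const_tag v (j : J) : const v -> v \in tag j.
  by move=> /asboolP/tag_closed; apply.
have const_values u v : team_values X u = team_values X v -> const u -> const v.
  move=> uv /asboolP cu; apply/asboolP => r r' rX r'X _.
  have /imfsetP[q /= qX ->] : r v \in team_values X u.
    by rewrite uv; apply/imfsetP; exists r.
  have /imfsetP[q' /= q'X ->] : r' v \in team_values X u.
    by rewrite uv; apply/imfsetP; exists r'.
  exact: cu.
pose in_tag v := [pred j : J | v \in tag j].
have card_in_tag v : #|in_tag v| = \sum_(Z : {set D} | v \in Z) a Z.
  transitivity (\sum_(Z : {set D} | v \in Z) \sum_(k < a Z) 1).
    by rewrite sig_big_dep -sum1_card; apply: eq_bigl => j; rewrite andbT.
  by apply: eq_bigr => Z _; rewrite sum1_card card_ord.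
(* Two rows per copy of each closed set [Z]: they agree exactly on [Z], and
   rows of different copies agree only on the variables constant in [X]. *)
pose row (q : J * bool) : {ffun D -> (nat * bool)%type} := [ffun v =>
  if const v then (0, false)
  else (rank (in_tag v) q.1, q.2 && (v \notin tag q.1))].
have row_eq i j b b' v :
    row (i, b) v = row (j, b') v <-> const v \/ i = j /\ (b = b' \/ v \in tag i).
  rewrite !ffunE /=; case: ifP => [cv|_]; first by split=> // _; left.
  split=> [[/rank_inj <-]|[//|[<- [<- //|vi]]]]; last by rewrite vi !andbF.
  have [vi|_] := boolP (v \in tag i); rewrite ?andbT; right; split=> //.
    by right.
  by left.
pose j0 : J := Tagged (fun Z => 'I_(a Z)) (Ordinal aW).
have [P [PD _ PM]] := uniform_team_sat R (j0, true) row.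
exists P; split=> [us vs d | x y xy | us vs /PD h st v].
- apply/PD => -[i b] [j b'] agr v /d{}d; apply/row_eq.
  (* For different copies, [us] is constant in [X], hence so is [v]; for the two rows of one copy,
     [us] lies in its closed set, hence so does [v]. *)
  have [ij|nij] := eqVneq i j; last first.
    left; apply/asboolP => r r' rX r'X _; apply: d => // z /agr/row_eq[|[ij]].
      by move/asboolP; apply.
    by rewrite ij eqxx in nij.
  have [bb|nbb] := eqVneq b b'; first by right; split=> //; left.
  right; split=> //; right; apply: tag_closed d _ => z /agr/row_eq[/const_tag //|].
  by case=> _ [bb|//]; rewrite bb eqxx in nbb.
- have val_xy := umi x y xy.
  have const_xy : const x = const y.
    by apply/idP/idP; apply: const_values; rewrite val_xy.
  (* For non-constant variables, an entry of [row] depends only on rank, bit and membership, so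
     matching copies by rank turns the column of [x] into that of [y]. *)
  have [|h h_inj hE] := @rank_match J (in_tag x) (in_tag y).
    by rewrite !card_in_tag; apply: a_bal; rewrite /nvals val_xy.
  apply/PM => c.
  pose H (q : J * bool) := (h q.1, q.2).
  have H_inj : injective H by move=> [i b] [j b'] [/h_inj-> ->].
  rewrite [RHS](reindex_inj H_inj) /=; apply: eq_bigl => -[i b].
  have [hr ht] := hE i; rewrite !ffunE const_xy /= hr.
  by move: ht; rewrite /= => ->.
(* The two rows of a copy of [W] agree only where [s] and [t] do, as these agree on constants
   too. *)
- have agr : {in us, row (j0, true) =1 row (j0, false)}.
    move=> z zus; apply/row_eq; right; split=> //; right.
    by rewrite inE; apply/eqP/st.
  move=> /(h _ _ agr)/row_eq[/asboolP|[_ [//|]]]; first by apply.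
  by rewrite inE => /eqP.
Qed.

(** * The two equivalences *)

Theorem theorem4p1 (R : realType) (D : finType)
    (SigmaFD : set (seq D * seq D)) (SigmaUMI : set (D * D)) :
  let Sigma := (fd_atoms SigmaFD `|` umi_atoms SigmaUMI)%classic in
  let SigmaStar := (fd_atoms SigmaFD `|` incl_atoms SigmaUMI)%classic in
  (forall xs ys : seq D,
     entails R Sigma (Dep xs ys) <-> entails R SigmaStar (Dep xs ys))
  /\
  (forall x y : D,
     entails R Sigma (MarginalId x y) <->
     (entails R SigmaStar (Incl x y) /\ entails R SigmaStar (Incl y x))).
Proof.
move=> Sigma SigmaStar.
have values_eq A (P : prob_team R D A) x y :
    (forall psi, SigmaStar psi -> sat P psi) -> SigmaUMI (x, y) ->
    team_values (Defs.support P) x = team_values (Defs.support P) y.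
  move=> PS xy; apply/eqP; rewrite eqEfsubset; apply/andP; split.
    by apply: (PS (Incl x y)); right; exists (x, y) => //; left.
  by apply: (PS (Incl y x)); right; exists (y, x) => //; right.
split=> [xs ys | x y]; split.
- move=> ent A P PS s t sP tP /agreeP st; apply/agreeP.
  have [Q [QD QM Qst]] := balanced_team R sP tP (fun x y => @values_eq A P x y PS).
  apply: Qst st; apply: ent => psi [[[us vs] /= p <-] | [[u v] /= uv <-]].
    apply: QD => v vvs r r' rP r'P /agreeP e; move: vvs; apply/agreeP: v.
    by apply: (PS (Dep us vs)) => //; left; exists (us, vs).
  exact: QM.
- move=> ent A P PS; apply: ent => psi [|[[u v] /= uv <-]].
    by move=> p; apply: PS; left.
  apply: MarginalId_Incl => a; case: uv => uv; last apply/esym; move: a;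
  [apply: (PS (MarginalId u v)) | apply: (PS (MarginalId v u))];
  by right; eexists; first exact: uv.
(* Here [k] sends a variable to its value set in [P]. *)
- move=> ent; split=> A P PS.
  - by have /= -> := entails_MarginalId_eq (fun u v => @values_eq A P u v PS) ent.
  - by have /= -> := entails_MarginalId_eq (fun u v => @values_eq A P u v PS) ent.
- move=> [ent _] A P PS.
  (* The marginal of [z] is encoded by the set of variables sharing it, which gives values in a
     finite type. *)
  pose k z := [set w | `[< marginal P w = marginal P z >]].
  have : k x = k y.
    apply: entails_Incl_eq ent => u v uv; suff e : marginal P u = marginal P v.
      by apply/setP => w; rewrite !inE e.
    by apply/funext; apply: (PS (MarginalId u v)); right; exists (u, v).
  move/setP/(_ x); rewrite !inE asboolT // => /esym/asboolP xy a.
  by rewrite xy.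
Qed.
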